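(* Let $k$ be a field, $R=k[x,y,z]$ with the standard grading, and let $s\geq 3$ be an integer. Let $I\subset R$ be a homogeneous ideal of grade $3$ such that $R/I$ is compressed with $\operatorname{Soc}(R/I)\cong k(-s)\oplus k(-2s+1)$. Write $I=I_1\cap I_2$, where $I_1,I_2$ are homogeneous grade $3$ Gorenstein ideals such that $R/I_1$ and $R/I_2$ have socle degrees $s$ and $2s-1$, respectively. Let $b=\dim_k\operatorname{Tor}_2^R(R/I_2,k)_{s+1}$ $(=\dim_k \operatorname{Tor}_1^R(R/I_2,k)_{s+1})$. Then there exists a minimal generating set $$(\phi_1,\dots,\phi_{s+1},\psi_1,\dots,\psi_b)$$ of $I_2$ consisting of homogeneous elements with $\deg(\phi_i)=s$ for all $i$ and $\deg(\psi_j)=s+1$ for all $j$, such that $$I=(\phi_1,\dots,\phi_s,\psi_1,\dots,\psi_b)+R_+\phi_{s+1}.$$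
   Context: $R_+=(x,y,z)$. The isomorphism $\operatorname{Soc}(R/I)\cong k(-s)\oplus k(-2s+1)$ is as graded $k$-vector spaces: the socle is $2$-dimensional with one basis element in degree $s$ and one in degree $2s-1$. For a homogeneous ideal $J\subset R$ with $R/J$ Artinian, let $c_\ell=\dim_k \operatorname{Soc}(R/J)_\ell$ and let $N$ be the largest integer with $(R/J)_N\neq 0$ (the top socle degree). $R/J$ is compressed if $\dim_k (R/J)_i=\min\{\binom{2+i}{i},\ \sum_{\ell=0}^{N} c_\ell\binom{2+\ell-i}{\ell-i}\}$ for $0\le i\le N$, where binomials with $\ell<i$ are $0$. A grade $3$ homogeneous Gorenstein ideal $J$ has $\operatorname{Soc}(R/J)$ one-dimensional, concentrated in a single degree called its socle degree. A decomposition $I=I_1\cap I_2$ as in the claim always exists. The ring $R/I_2$ is compressed, and its only nonzero graded Betti numbers are: $1$ for $\operatorname{Tor}_0$ in degree $0$; $s+1$ and $b$ for $\operatorname{Tor}_1$ in degrees $s$ and $s+1$; $b$ and $s+1$ for $\operatorname{Tor}_2$ in degrees $s+1$ and $s+2$; $1$ for $\operatorname{Tor}_3$ in degree $2s+2$. *)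

(* Defs.v *)
From HB Require Import structures.
From mathcomp Require Import all_boot all_order all_algebra.
From mathcomp Require Import mpoly ring.

Set Implicit Arguments.
Unset Strict Implicit.
Unset Printing Implicit Defensive.

Import GRing.Theory.
Local Open Scope ring_scope.

(* Conventions.  R = {mpoly k[3]} with the standard grading; d.-homog is the
   library's predicate, so 0 is d.-homog for every d.  Ideals of R are the
   idealr R of ring_quotient; these are proper ideals.  Quotients are never
   formed: an element of R/J is represented by a polynomial modulo J. *)

Section Definitions.

Context (k : fieldType).
Local Notation R := {mpoly k[3]}.

(* The ideal generated by the members t, with P t, of a finite family. *)
Definition gen_ideal (T : finType) (P : pred T) (g : T -> R) (f : R) : Prop :=
  exists a : T -> R, f = \sum_(t | P t) a t * g t.

(* R_+ = (x, y, z) *)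
Definition irrelevant (f : R) : Prop :=
  gen_ideal predT (fun i : 'I_3 => 'X_i) f.

Definition homogeneous (J : idealr R) : Prop :=
  forall (d : nat) (f : R), f \in J -> pihomog mdeg d f \in J.

Definition regular_sequence (n : nat) (f : 'I_n -> R) : Prop :=
  (forall (i : 'I_n) (g : R),
     gen_ideal [pred j : 'I_n | (j < i)%N] f (g * f i) ->
     gen_ideal [pred j : 'I_n | (j < i)%N] f g)
  /\ ~ gen_ideal predT f 1.

(* g is the supremum of the lengths of the R-regular sequences in J. *)
Definition grade (J : idealr R) (g : nat) : Prop :=
  (exists f : 'I_g -> R, (forall i, f i \in J) /\ regular_sequence f)
  /\ (forall (n : nat) (f : 'I_n -> R),
        (forall i, f i \in J) -> regular_sequence f -> (n <= g)%N).

(* For k-subspaces U and W of an R-module: dim_k U / (U :&: W) = n, that is,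
   the classes modulo W of some n elements of U form a k-basis of the image of
   U modulo W.  The scalar c in k acts as the constant polynomial c%:MP. *)
Definition quot_dim (V : lmodType R) (U W : V -> Prop) (n : nat) : Prop :=
  exists e : 'I_n -> V,
    (forall i, U (e i)) /\
    (forall v, U v ->
       exists! c : 'rV[k]_n, W (v - \sum_i (c 0 i)%:MP *: e i)).

(* dim_k (R/J)_d = n *)
Definition hilbert (J : idealr R) (d n : nat) : Prop :=
  @quot_dim R^o (fun f => (f : R) \is d.-homog) (fun f => (f : R) \in J) n.

(* f represents an element of Soc(R/J) = 0 :_{R/J} R_+ *)
Definition in_socle (J : idealr R) (f : R) : Prop :=
  forall g, irrelevant g -> g * f \in J.

(* dim_k Soc(R/J)_d = n *)
Definition socle_dim (J : idealr R) (d n : nat) : Prop :=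
  @quot_dim R^o (fun f => (f : R) \is d.-homog /\ in_socle J f)
    (fun f => (f : R) \in J) n.

(* dim_k Soc(R/J) = n, with no reference to degrees *)
Definition artinian_type (J : idealr R) (n : nat) : Prop :=
  @quot_dim R^o (in_socle J) (fun f => (f : R) \in J) n.

(* For J of grade 3 the ring R/J is Artinian, hence Cohen-Macaulay, and it is
   Gorenstein when it has type one. *)
Definition grade3_Gorenstein (J : idealr R) : Prop :=
  [/\ homogeneous J, grade J 3 & artinian_type J 1].

Definition socle_degree (J : idealr R) (e : nat) : Prop :=
  forall d, socle_dim J d (d == e).

(* N is the largest integer with (R/J)_N <> 0. *)
Definition top_degree (J : idealr R) (N : nat) : Prop :=
  (exists2 f : R, f \is N.-homog & f \notin J)
  /\ (forall (d : nat) (f : R), (N < d)%N -> f \is d.-homog -> f \in J).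

Definition compressed (J : idealr R) : Prop :=
  exists (N : nat) (c : nat -> nat),
    [/\ top_degree J N,
        forall l, socle_dim J l (c l)
      & forall i, (i <= N)%N ->
          hilbert J i
            (minn 'C(2 + i, i)
                  (\sum_(i <= l < N.+1) c l * 'C(2 + (l - i), l - i)))].

(* The g t form an irredundant family of generators of J. *)
Definition minimal_generators (T : finType) (g : T -> R) (J : idealr R) : Prop :=
  (forall f, f \in J <-> gen_ideal predT g f)
  /\ (forall P : pred T,
        (forall f, f \in J <-> gen_ideal P g f) -> forall t, P t).

(* A graded free resolution
     ... -> F_2 -> F_1 -> F_0 -> k -> 0,   F_i = \bigoplus_a R(- shift i a),
   of k = R/R_+.  Elements of F_i are row vectors and res_diff i : F_(i+1) -> F_i
   acts on the right.  The degree 0 map F_0 -> k sends the basis vector with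
   index a to res_aug a. *)
Record graded_resolution := GradedResolution {
  res_rank : nat -> nat;
  res_shift : forall i, 'I_(res_rank i) -> nat;
  res_diff : forall i, 'M[R]_(res_rank i.+1, res_rank i);
  res_aug : 'I_(res_rank 0) -> k;
  res_diff_homog : forall i a b,
    if (res_shift b <= res_shift a)%N
    then res_diff i a b \is (res_shift a - res_shift b).-homog
    else res_diff i a b == 0;
  res_aug_homog : forall a, res_shift a != 0%N -> res_aug a = 0;
  res_aug_surj : exists a, res_aug a != 0;
  res_exact0 : forall u : 'rV[R]_(res_rank 0),
    \sum_a (u 0 a)@_0%MM * res_aug a = 0 <-> exists v, u = v *m res_diff 0;
  res_exactS : forall i (u : 'rV[R]_(res_rank i.+1)),
    u *m res_diff i = 0 <-> exists v, u = v *m res_diff i.+1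
}.

Section Tor.

Context (F : graded_resolution) (J : idealr R).

(* u is in the component of degree d of F_i *)
Definition chain_homog (i d : nat) (u : 'rV[R]_(res_rank F i)) : Prop :=
  forall a, if (res_shift a <= d)%N
            then u 0 a \is (d - res_shift a).-homog else u 0 a == 0.

(* u is zero in F_i (x) R/J *)
Definition chain_mod (i : nat) (u : 'rV[R]_(res_rank F i)) : Prop :=
  forall a, u 0 a \in J.

Definition tor_cycle (i : nat) : 'rV[R]_(res_rank F i) -> Prop :=
  match i return 'rV[R]_(res_rank F i) -> Prop with
  | 0%N => fun _ => True
  | j.+1 => fun u => chain_mod (u *m res_diff F j)
  end.

Definition tor_boundary (i : nat) (u : 'rV[R]_(res_rank F i)) : Prop :=
  exists v, chain_mod (u - v *m res_diff F i).

(* dim_k H_i(F (x) R/J)_d = n *)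
Definition resolution_tor_dim (i d n : nat) : Prop :=
  quot_dim (fun u => @chain_homog i d u /\ tor_cycle u) (@tor_boundary i) n.

End Tor.

End Definitions.

Arguments irrelevant {k} f.

(* The Koszul resolution of k: with K_1 and K_2 identified with R^3 and
   X = (x, y, z), the three maps are u |-> u . X, u |-> u \times X (the cross
   product) and a |-> a X. *)
Section Koszul.

Context (k : fieldType).
Local Notation R := {mpoly k[3]}.

Definition koszul_rank (i : nat) : nat :=
  match i with 0 => 1 | 1 => 3 | 2 => 3 | 3 => 1 | _ => 0 end.

Definition cross_mx : 'M[R]_3 :=
  let x := 'X_(0 : 'I_3) in let y := 'X_(1 : 'I_3) in let z := 'X_(2 : 'I_3) in
  \matrix_(a, b) nth 0 (nth [::] [:: [:: 0; - z; y];
                                     [:: z; 0; - x];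
                                     [:: - y; x; 0]] a) b.

Definition koszul_diff (i : nat) : 'M[R]_(koszul_rank i.+1, koszul_rank i) :=
  match i return 'M[R]_(koszul_rank i.+1, koszul_rank i) with
  | 0 => \col_a 'X_a
  | 1 => cross_mx
  | 2 => \row_a 'X_a
  | _ => 0
  end.

Lemma mcoeffMXi (i : 'I_3) (f : R) (m : 'X_{1..3}) :
  (f * 'X_i)@_m = if m i == 0%N then 0 else f@_(m - U_(i))%MM.
Proof.
case: eqP => [mi0 | /eqP mi0].
  have -> : (f * 'X_i) = \sum_(p <- msupp f) f@_p *: 'X_[p + U_(i)].
    rewrite {1}[f]mpolyE mulr_suml; apply: eq_bigr => p _.
    by rewrite -scalerAl -mpolyXD.
  rewrite raddf_sum /= big1 // => p _; rewrite mcoeffZ mcoeffX.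
  case: eqP => [E|]; last by rewrite mulr0.
  by move: mi0; rewrite -E mnmDE mnm1E eqxx addn1.
have E : m = (U_(i) + (m - U_(i)))%MM.
  apply/mnmP => j; rewrite mnmDE mnmBE mnm1E; case: eqP => [<-|_] /=.
    by rewrite subnKC // lt0n.
  by rewrite subn0.
by rewrite [in LHS]E mcoeffMX.
Qed.

Definition freeof (i : 'I_3) (f : R) :=
  forall m : 'X_{1..3}, m i != 0%N -> f@_m = 0.

Lemma freeofMX (i j : 'I_3) f : i != j -> freeof i f -> freeof i (f * 'X_j).
Proof.
move=> ij hf m mi; rewrite mcoeffMXi; case: ifP => // _; apply: hf.
by rewrite mnmBE mnm1E [j == i]eq_sym (negPf ij) subn0.
Qed.

Lemma freeofD (i : 'I_3) f g : freeof i f -> freeof i g -> freeof i (f + g).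
Proof. by move=> hf hg m mi; rewrite mcoeffD hf // hg // addr0. Qed.

Lemma divX (i : 'I_3) (f : R) : exists h r, f = h * 'X_i + r /\ freeof i r.
Proof.
elim/mpolyind: f => [|c m p _ _ [h [r [-> hr]]]].
  by exists 0, 0; split=> [|m _]; rewrite ?mcoeff0 // mul0r addr0.
have [mi0|mi0] := eqVneq (m i) 0%N.
  exists h, (c *: 'X_[m] + r); split; first by ring.
  apply: freeofD => // m' mi'; rewrite mcoeffZ mcoeffX.
  by case: eqP => [E|_]; [rewrite -E mi0 in mi' | rewrite mulr0].
exists (c *: 'X_[(m - U_(i))] + h), r; split=> //.
have -> : 'X_[m] = 'X_[(m - U_(i))] * 'X_i :> R.
  rewrite -mpolyXD; congr ('X_[_]).
  apply/mnmP => j; rewrite mnmDE mnmBE mnm1E; case: eqP => [<-|] //=.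
    by rewrite subnK // lt0n.
  by rewrite subn0 addn0.
by rewrite mulrDl -scalerAl addrA.
Qed.

Lemma freeof_split (i : 'I_3) g s :
  freeof i s -> g * 'X_i + s = 0 -> g = 0 /\ s = 0 :> R.
Proof.
move=> hs E; suff g0 : g = 0 by split=> //; rewrite g0 mul0r add0r in E.
apply/mpolyP => m; rewrite mcoeff0.
have /(congr1 (fun p : R => p@_(m + U_(i))%MM)) := E.
rewrite mcoeffD mcoeff0 mcoeffMXi mnmDE mnm1E eqxx addn1 /= addmK.
by rewrite hs ?addr0 // mnmDE mnm1E eqxx addn1.
Qed.

Lemma X_neq0 (i : 'I_3) : 'X_i != 0 :> R.
Proof. by rewrite -msize_poly_eq0 mmeasureX. Qed.

Lemma dvdX (i j : 'I_3) (f g : R) : i != j ->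
  g * 'X_j = f * 'X_i -> exists h, g = h * 'X_i.
Proof.
move=> ij E; have [h [r [Eg hr]]] := divX i g.
have [||_ /eqP] := @freeof_split i (h * 'X_j - f) (r * 'X_j).
- exact: freeofMX.
- by rewrite -(subrr (g * 'X_j)) {2}E Eg; ring.
- rewrite mulf_eq0 (negPf (X_neq0 j)) orbF => /eqP r0.
  by exists h; rewrite Eg r0 addr0.
Qed.

Lemma koszul_exact0 (u : 'rV[R]_(koszul_rank 0)) :
  \sum_a (u 0 a)@_0%MM * 1 = 0 <-> exists v, u = v *m koszul_diff 0.
Proof.
rewrite big_ord1 mulr1; split=> [u0 | [v ->]]; last first.
  rewrite mxE raddf_sum /= big1 // => j _.
  by rewrite mxE mcoeffMXi mnm0E.
suff H (f : R) : exists v : 'rV[R]_3, f - (f@_0)%:MP = (v *m \col_a 'X_a) 0 0.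
  have [v Ev] := H (u 0 0); exists v; apply/rowP => a.
  by rewrite [a]ord1 -Ev u0 mpolyC0 subr0.
elim/mpolyind: f => [|c m p _ _ [v Ev]].
  by exists 0; rewrite mul0mx !mxE mcoeff0 mpolyC0 subr0.
have [->|m0] := eqVneq m 0%MM.
  exists v; rewrite -Ev mcoeffD mpolyCD mcoeffZ mcoeffX eqxx mulr1.
  by rewrite mpolyX0 -mul_mpolyC mulr1; ring.
have [i mi] : exists i, m i != 0%N.
  apply/existsP; apply: contraNT m0; rewrite negb_exists => /forallP H.
  by apply/eqP/mnmP => i; rewrite mnm0E; apply/eqP; rewrite -[_ == _]negbK.
exists (v + (c *: 'X_[(m - U_(i))]) *: delta_mx 0 i).
rewrite mulmxDl mxE -Ev -scalemxAl -rowE !mxE.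
rewrite mcoeffD mcoeffZ mcoeffX (negPf m0) mulr0 add0r -scalerAl -mpolyXD.
have -> : (m - U_(i) + U_(i) = m)%MM; last by rewrite [RHS]addrC addrA.
apply/mnmP => j; rewrite mnmDE mnmBE mnm1E; case: eqP => [<-|] //=.
  by rewrite subnK // lt0n.
by rewrite subn0 addn0.
Qed.

Let o0 : 'I_3 := 0.
Let o1 : 'I_3 := 1.
Let o2 : 'I_3 := 2.

Lemma sum3 (f : 'I_3 -> R) : \sum_i f i = f o0 + f o1 + f o2.
Proof.
rewrite !big_ord_recl big_ord0 addr0 addrA.
by congr (f _ + f _ + f _); apply/val_inj.
Qed.

Lemma row3P (u v : 'rV[R]_3) :
  [/\ u 0 o0 = v 0 o0, u 0 o1 = v 0 o1 & u 0 o2 = v 0 o2] -> u = v.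
Proof.
move=> [e0 e1 e2]; apply/rowP => -[[|[|[|//]]] H].
- by rewrite (_ : Ordinal H = o0) //; apply/val_inj.
- by rewrite (_ : Ordinal H = o1) //; apply/val_inj.
- by rewrite (_ : Ordinal H = o2) //; apply/val_inj.
Qed.

Lemma mul_cross (u : 'rV[R]_3) :
  [/\ (u *m cross_mx) 0 o0 = u 0 o1 * 'X_o2 - u 0 o2 * 'X_o1,
      (u *m cross_mx) 0 o1 = u 0 o2 * 'X_o0 - u 0 o0 * 'X_o2
    & (u *m cross_mx) 0 o2 = u 0 o0 * 'X_o1 - u 0 o1 * 'X_o0].
Proof.
by split; rewrite mxE sum3 !mxE /=; ring.
Qed.

Lemma mul_dot (u : 'rV[R]_3) :
  (u *m \col_a 'X_a) 0 0 = u 0 o0 * 'X_o0 + u 0 o1 * 'X_o1 + u 0 o2 * 'X_o2.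
Proof. by rewrite mxE sum3 !mxE. Qed.

Lemma koszul_exact1 (u : 'rV[R]_3) :
  u *m (\col_a 'X_a) = 0 <-> exists v, u = v *m cross_mx.
Proof.
split=> [|[v ->]]; last first.
  apply/rowP => a; rewrite [a]ord1 mul_dot [RHS]mxE.
  by have [-> -> ->] := mul_cross v; ring.
move=> /rowP /(_ 0); rewrite mul_dot mxE.
have [q [t [E1 ht]]] := divX o0 (u 0 o1).
have [p [r [E2 hr]]] := divX o0 (u 0 o2).
move=> E.
have [||a0 b0] := @freeof_split o0 (u 0 o0 + q * 'X_o1 + p * 'X_o2)
                                   (t * 'X_o1 + r * 'X_o2).
- by apply: freeofD; apply: freeofMX.
- by rewrite -[RHS]E E1 E2; ring.
have Etr : t * 'X_o1 = - r * 'X_o2.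
  by apply/eqP; rewrite -subr_eq0 mulNr opprK b0.
have [w Ew] := @dvdX o2 o1 (- r) t isT Etr.
have Er : r = - w * 'X_o1.
  apply: (mulIf (X_neq0 o2)); apply/eqP; rewrite -subr_eq0 -[X in _ == X]b0 Ew.
  by apply/eqP; ring.
have E0 : u 0 o0 = - q * 'X_o1 - p * 'X_o2.
  by apply/eqP; rewrite -subr_eq0 -[X in _ == X]a0; apply/eqP; ring.
exists (\row_a if a == o0 then - w else if a == o1 then - p else q).
apply: row3P; have [-> -> ->] := mul_cross
  (\row_a if a == o0 then - w else if a == o1 then - p else q).
by rewrite !mxE /= E0 E1 E2 Ew Er; split; ring.
Qed.

Lemma koszul_exact2 (u : 'rV[R]_3) :
  u *m cross_mx = 0 <-> exists v : 'rV[R]_1, u = v *m (\row_a 'X_a).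
Proof.
have rowE (v : 'rV[R]_1) b : (v *m (\row_a 'X_a)) 0 b = v 0 0 * 'X_b.
  by rewrite mxE big_ord1 mxE.
have [c0 c1 c2] := mul_cross u; split=> [E|[v Ev]]; last first.
  by apply: row3P; rewrite c0 c1 c2 !mxE Ev !rowE; split; ring.
rewrite E mxE in c0; rewrite E mxE in c1; rewrite E mxE in c2.
have E01 : u 0 o0 * 'X_o1 = u 0 o1 * 'X_o0 by apply/eqP; rewrite -subr_eq0 -c2.
have [a Ea] := @dvdX o0 o1 (u 0 o1) (u 0 o0) isT E01.
exists a%:M; apply: row3P; rewrite !rowE !mxE eqxx mulr1n; split=> //.
- apply: (mulIf (X_neq0 o0)); apply/eqP; rewrite eq_sym -subr_eq0 [X in _ == X]c2.
  by rewrite Ea; apply/eqP; ring.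
- apply: (mulIf (X_neq0 o0)); apply/eqP; rewrite -subr_eq0 [X in _ == X]c1.
  by rewrite Ea; apply/eqP; ring.
Qed.

Lemma koszul_exactS i (u : 'rV[R]_(koszul_rank i.+1)) :
  u *m koszul_diff i = 0 <-> exists v, u = v *m koszul_diff i.+1.
Proof.
case: i u => [|[|[|i]]] u.
- exact: koszul_exact1.
- exact: koszul_exact2.
- split=> [/rowP/(_ o0) | [v ->]]; last by rewrite /= mulmx0 mul0mx.
  rewrite mxE big_ord1 !mxE => /eqP.
  rewrite mulf_eq0 (negPf (X_neq0 o0)) orbF => /eqP u0.
  by exists 0; apply/rowP => a; rewrite [a]ord1 u0 /= mulmx0 mxE.
- by split=> _; [exists 0; apply/rowP => -[] | rewrite /= mulmx0].
Qed.

Lemma koszul_diff_homog i a b :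
  if (i <= i.+1)%N then koszul_diff i a b \is (i.+1 - i).-homog
  else koszul_diff i a b == 0.
Proof.
have hX (j : 'I_3) : 'X_j \is [in k[3], 1.-homog] by rewrite dhomogX /= mdeg1.
rewrite leqnSn subSnn; case: i a b => [|[|[|i]]] a b; rewrite mxE //.
- by case: a b => [[|[|[|//]]] ?] [[|[|[|//]]] ?] /=; rewrite ?rpredN ?rpred0.
- exact: rpred0.
Qed.

Definition koszul : graded_resolution k :=
  @GradedResolution k koszul_rank (fun i _ => i) koszul_diff (fun _ => 1)
    koszul_diff_homog (fun a H => False_ind _ (elimN eqP H erefl))
    (ex_intro _ 0 (oner_neq0 k)) koszul_exact0 koszul_exactS.

End Koszul.

(* dim_k Tor_i^R(R/J, k)_d = n *)
Definition tor_dim (k : fieldType) (J : idealr {mpoly k[3]}) (i d n : nat) :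
  Prop := resolution_tor_dim (koszul k) J i d n.

(* Main.v *)
(** Everything in degree at least 2s lies in I, and everything in degree above s
    lies in I_1, so I and I_2 agree above degree s.  The degree-s socle element
    p of R/I lies in I_2, because R/I_2 has no socle in degree s; it is not in
    I_1, whose quotient is one-dimensional in degree s, so (I_2)_s = I_s + k p,
    while R_+ p lies in I.  A generating set of I_2 whose last degree-s member
    is p and whose other members lie in I is therefore what is wanted.

    It remains to see that I_2 has s + 1 generators in degree s, b in degree
    s + 1 and no others.  The Hilbert function of R/I gives
    dim (I_2)_s = s + 1 and dim (I_2)_(s+1) = 3(s + 1).  Let L be the functional
    on R given by the socle of R/I_2, so that h is in I_2 iff L vanishes on R h.
    The pairing (f, g) |-> L (f g) between degrees s - 1 and s forces
    (I_2)_(s-1) = 0.  Koszul homology of R/I_2 is self-dual under this pairing;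
    since I_2 vanishes below degree s, Tor_2 vanishes in degrees at most s, hence
    Tor_1 vanishes in degrees at least s + 2.  Finally the cross product with
    (x, y, z) identifies Tor_2 in degree s + 1 with the kernel of
    R_1 (x) (I_2)_s -> (I_2)_(s+1), whose cokernel then also has dimension b. *)

From HB Require Import structures.
From Stdlib Require Import Classical.
Require Import Defs.
From mathcomp Require Import all_boot all_order all_algebra.
From mathcomp Require Import mpoly ring zify.

Set Implicit Arguments.
Unset Strict Implicit.
Unset Printing Implicit Defensive.

Import GRing.Theory.
Local Open Scope ring_scope.

(** * Linear algebra *)

Section LinearAlgebra.

Variable K : fieldType.

(** A subspace inside [P] is enlarged one vector at a time; [n] bounds the dimension still
    available, so the growth stops. *)
Lemma vspace_of_pred (V : vectType K) (P : V -> Prop) :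
  P 0 -> (forall a u v, P u -> P v -> P (a *: u + v)) ->
  exists U : {vspace V}, forall v, v \in U <-> P v.
Proof.
move=> P0 Plin.
suff H n (U : {vspace V}) : (\dim {:V} <= n + \dim U)%N ->
    (forall v, v \in U -> P v) -> exists U : {vspace V}, forall v, v \in U <-> P v.
  apply: (H (\dim {:V}) 0%VS); first by rewrite leq_addr.
  by move=> v; rewrite memv0 => /eqP->.
elim: n U => [|n IH] U dU UP.
  exists U => v; split=> [/UP //|_].
  have /eqP -> : U == fullv by rewrite eqEdim subvf.
  exact: memvf.
have [[v [Pv vU]]|no] := classic (exists v, P v /\ v \notin U); last first.
  exists U => v; split=> [/UP //|Pv]; apply/negP => vU.
  by apply: no; exists v; split=> //; apply/negP.
apply: (IH (<[v]> + U)%VS) => [|w /memv_addP[x /vlineP[a ->] [u /UP Pu ->]]].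
  apply: leq_trans dU _; rewrite addSnnS leq_add2l ltn_neqAle dimvS ?addvSr // andbT.
  apply: contra vU => /eqP E; have /eqP UE : U == (<[v]> + U)%VS.
    by rewrite eqEdim addvSr E leqnn.
  rewrite UE.  by apply: (subvP (addvSl _ _)); exact: memv_line.
exact: Plin.
Qed.

(** The values of the [T j] on [B] form a subspace of a finite-dimensional space, and a vector
    outside a subspace is detected by a linear form vanishing on it. [E] itself may have infinite
    dimension. *)
Lemma finite_separation (E : lmodType K) (B : E -> Prop) (J : finType)
    (T : J -> E -> K) (x : E) :
  (forall j a u v, T j (a *: u + v) = a * T j u + T j v) ->
  B 0 -> (forall a u v, B u -> B v -> B (a *: u + v)) ->
  (forall c : J -> K, (forall b, B b -> \sum_j c j * T j b = 0) ->
     \sum_j c j * T j x = 0) ->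
  exists2 b, B b & forall j, T j b = T j x.
Proof.
move=> Tlin B0 Blin H.
pose F (y : E) : {ffun J -> K^o} := [ffun j => T j y].
have Flin a u v : F (a *: u + v) = a *: F u + F v.
  by apply/ffunP => j; rewrite !ffunE Tlin.
have [||S HS] := @vspace_of_pred {ffun J -> K^o} (fun y => exists2 b, B b & F b = y).
- exists 0 => //; apply/ffunP => j; rewrite !ffunE.
  by have := Tlin j (-1) 0 0; rewrite scaler0 addr0 mulN1r addNr.
- move=> a _ _ [u Bu <-] [v Bv <-]; exists (a *: u + v); first exact: Blin.
  exact: Flin.
suff /HS[b Bb Eb] : F x \in S.
  by exists b => // j; move/ffunP/(_ j): Eb; rewrite !ffunE.
pose q y := y - projv S y.
have qS y : q y = 0 -> y \in S by move/subr0_eq->; exact: memv_proj.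
apply/qS/ffunP => i; rewrite [RHS]ffunE.
pose e j : {ffun J -> K^o} := [ffun i => (i == j)%:R].
(* Each coordinate of [q] is a linear form vanishing on [S], with coefficients [q (e j) i]. *)
have qE y : q y i = \sum_j q (e j) i * y j.
  have {1}-> : y = \sum_j y j *: e j.
    apply/ffunP => l; rewrite sum_ffunE (bigD1 l) //= big1 => [|j /negPf jl].
      by rewrite !ffunE eqxx addr0 [LHS](esym (mulr1 _)).
    by rewrite !ffunE eq_sym jl [LHS]mulr0.
  rewrite /q linear_sum -sumrB sum_ffunE; apply: eq_bigr => j _.
  by rewrite linearZ -scalerBr !ffunE mulrC.
rewrite qE; under eq_bigr => j do rewrite [F x j]ffunE.
apply: H => b Bb; transitivity (q (F b) i).
  by rewrite qE; apply: eq_bigr => j _; rewrite [F b j]ffunE.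
by rewrite /q projv_id ?subrr ?ffunE //; apply/HS; exists b.
Qed.

(* The classes modulo W of elements of U are represented by the image of U
   under a linear map T whose kernel in U is W. *)
Lemma quot_dimE (V : lmodType {mpoly K[3]}) (E : vectType K) (U W : V -> Prop)
    (T : V -> E) (A : {vspace E}) n :
  (forall a u v, T (a%:MP *: u + v) = a *: T u + T v) ->
  U 0 -> (forall a u v, U u -> U v -> U (a%:MP *: u + v)) ->
  (forall v, U v -> (W v <-> T v = 0)) ->
  (forall x, x \in A <-> exists2 v, U v & T v = x) ->
  quot_dim U W n -> n = \dim A.
Proof.
move=> Tlin U0 Ulin WT AE [e [Ue He]].
have T0 : T 0 = 0.
  by have := Tlin (-1) 0 0; rewrite scaler0 addr0 scaleN1r addNr.
have comb (c : 'I_n -> K) v : U v ->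
    U (v - \sum_i (c i)%:MP *: e i)
    /\ T (v - \sum_i (c i)%:MP *: e i) = T v - \sum_i c i *: T (e i).
  move=> Uv; elim/big_rec2: _ => [|i y x _ [Ux Ex]]; first by rewrite !subr0.
  have -> : v - ((c i)%:MP *: e i + x) = (- c i)%:MP *: e i + (v - x).
    by rewrite mpolyCN scaleNr opprD addrCA.
  split; first exact: Ulin.
  by rewrite Tlin Ex scaleNr opprD addrCA.
pose X := [tuple T (e i) | i < n].
have XE (i : 'I_n) : X`_i = T (e i) by rewrite -tnth_nth tnth_mktuple.
suff: basis_of A X by move/vector.size_basis.
have fX : free X.
  apply/freeP => c; under eq_bigr => i _ do rewrite XE.
  move=> c0.
  (* Both the zero row and the row of the [c i] are coordinates of 0 modulo [W], so uniqueness gives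
     freeness. *)
  have [c1 [_ Uc]] := He 0 U0.
  have E1 : c1 = 0.
    apply: Uc; have [Uz Tz] := comb (fun i => (0 : 'rV[K]_n) 0 i) 0 U0.
    apply/WT => //; rewrite Tz T0 big1 ?subr0 // => i _.
    by rewrite mxE scale0r.
  have E2 : c1 = \row_i c i.
    apply: Uc; have [Uz Tz] := comb (fun i => (\row_i c i) 0 i) 0 U0.
    apply/WT => //; rewrite Tz T0 (eq_bigr (fun i => c i *: T (e i))).
      by rewrite c0 subr0.
    by move=> i _; rewrite mxE.
  by move=> i; move/rowP/(_ i): E2; rewrite E1 !mxE.
have AX : (A <= <<X>>)%VS.
  apply/subvP => x /AE[v Uv <-].
  have [c [Wc _]] := He v Uv.
  have [Uz Tz] := comb (fun i => c 0 i) v Uv.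
  move/WT: Wc => /(_ Uz); rewrite Tz => /subr0_eq ->.
  apply: memv_suml => i _; apply/memvZ/memv_span.
  by rewrite -XE mem_nth // size_tuple.
have XA : (<<X>> <= A)%VS.
  apply/span_subvP => x /tnthP[i ->]; rewrite tnth_mktuple.
  by apply/AE; exists (e i).
by rewrite basisEfree fX XA -(eqP fX) dimvS.
Qed.
End LinearAlgebra.

(** * Homogeneous components *)

Section Graded.

Variable k : fieldType.
Local Notation R := {mpoly k[3]}.
Local Notation pi d := (@pihomog 3 k mdeg d).

Lemma homogX (i : 'I_3) : ('X_i : R) \is 1.-homog.
Proof. by rewrite dhomogX /= mdeg1. Qed.

Lemma pihomogM d e (f g : R) : f \is d.-homog ->
  pi e (f * g) = if (d <= e)%N then f * pi (e - d)%N g else 0.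
Proof.
move=> hf; rewrite {1}(pihomog_partitionE (leqnn (mmeasure mdeg g))).
rewrite mulr_sumr raddf_sum /=.
transitivity (\sum_(i < mmeasure mdeg g)
    if (d <= e)%N then f * pi (e - d)%N (pi i g) else 0); last first.
  case: ifP => _; last by rewrite big1.
  by rewrite -mulr_sumr -raddf_sum /= -pihomog_partitionE.
apply: eq_bigr => i _; have hfi := dhomogM hf (pihomogP mdeg i g).
have [Ee|ne] := eqVneq (d + i)%N e.
  by rewrite -Ee leq_addr addKn pihomog_id pihomog_dE.
rewrite (pihomog_ne0 ne hfi); case: ifP => // de.
rewrite (@pihomog_ne0 _ _ _ i) ?mulr0 ?pihomogP //.
by apply: contra ne => /eqP->; rewrite subnKC.
Qed.

Lemma pihomogMX d (f : R) (i : 'I_3) : pi d.+1 (f * 'X_i) = pi d f * 'X_i.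
Proof. by rewrite mulrC (pihomogM _ _ (homogX i)) /= subn1 mulrC. Qed.

Lemma mem_homog_components (J : idealr R) (f : R) :
  (forall d, pi d f \in J) -> f \in J.
Proof.
move=> H; rewrite (pihomog_partitionE (leqnn (mmeasure mdeg f))).
by apply: rpred_sum => i _.
Qed.

(** The nontrivial direction is exactness of the Koszul resolution at its zeroth term. *)
Lemma irrelevantE (f : R) : irrelevant f <-> f@_0%MM = 0.
Proof.
split=> [[a ->]|f0].
  by rewrite raddf_sum big1 // => i _ /=; rewrite mcoeffMXi mnm0E.
have [|v /rowP/(_ 0) E] := (koszul_exact0 (const_mx f)).1.
  by rewrite big_ord1 mxE mulr1.
exists (fun i => v 0 i); move: E; rewrite !mxE /= => ->.
by apply: eq_bigr => i _; rewrite mxE.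
Qed.

Lemma homog_irrelevant d (f : R) : f \is d.+1.-homog ->
  exists2 g : 'I_3 -> R, forall i, g i \is d.-homog & f = \sum_i g i * 'X_i.
Proof.
move=> hf; have [|a Ea] := (irrelevantE f).2.
  by rewrite (dhomog_nemf_coeff hf) //= mdeg0.
exists (fun i => pi d (a i)) => [i|]; first exact: pihomogP.
rewrite -[LHS](pihomog_dE hf) Ea raddf_sum; apply: eq_bigr => i _ /=.
exact: pihomogMX.
Qed.

Lemma idealMl (J : idealr R) (a f : R) : f \in J -> a * f \in J.
Proof. exact: idealMr. Qed.

Lemma in_socleE (J : idealr R) (f : R) :
  in_socle J f <-> forall i : 'I_3, 'X_i * f \in J.
Proof.
split=> [H i|H g [a ->]].
  by apply/H/irrelevantE; rewrite mcoeffX; case: eqP => // /eqP; rewrite mnm1_eq0.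
rewrite mulr_suml; apply: rpred_sum => i _; rewrite -mulrA; exact: idealMl.
Qed.

Lemma socle_dim0 (J : idealr R) d (f : R) : socle_dim J d 0 ->
  f \is d.-homog -> in_socle J f -> f \in J.
Proof.
move=> [e [_ H]] hf sf; have [c [+ _]] := H f (conj hf sf).
by rewrite big_ord0 subr0.
Qed.

(** While the class is outside the socle, some variable carries it to a nonzero class one degree
    higher; degrees stop at [N], so this ends. *)
Lemma socle_above (J : idealr R) N d (f : R) :
  (forall e g, (N < e)%N -> g \is e.-homog -> g \in J) ->
  f \is d.-homog -> f \notin J ->
  exists e m, [/\ (d <= e)%N, m \is (e - d).-homog, m * f \notin J
                & in_socle J (m * f)].
Proof.
move=> top; move: {2}(N.+1 - d)%N (leqnn (N.+1 - d)) => n.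
elim: n d f => [|n IH] d f dn hf fJ.
  by case/negP: fJ; apply: (top d) => //; rewrite -subn_eq0 -leqn0.
have [sf|] := classic (in_socle J f).
  by exists d, 1; rewrite mul1r subnn dhomog1.
move/(fun h => h \o (in_socleE J f).2)/not_all_ex_not => [i /negP Xf].
have [|||e [m [de hm mf sf]]] := IH d.+1 ('X_i * f) => //.
- by lia.
- exact: dhomogM (homogX i) hf.
exists e, (m * 'X_i); rewrite -mulrA; split=> //; first exact: ltnW.
have -> : (e - d = (e - d.+1) + 1)%N by lia.
exact: dhomogM hm (homogX i).
Qed.

End Graded.

(** * Hilbert functions and socles *)

Section Hilbert.

Variable k : fieldType.
Local Notation R := {mpoly k[3]}.
Local Notation pi d := (@pihomog 3 k mdeg d).
Local Notation H d := (dhomog 3 k d).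

Lemma dim_dhomog d : \dim {:H d} = 'C(d + 2, 2).
Proof. by rewrite dimvf /dim /= -bin_sub ?leq_addr // addKn. Qed.

Definition component d (f : R) : H d := DHomog (pihomogP mdeg d f).

Lemma val_component d f : \val (component d f) = pi d f.
Proof. by []. Qed.

Lemma component_is_linear d : linear (component d).
Proof. by move=> a u v; apply/val_inj; rewrite /= linearP. Qed.

HB.instance Definition _ d :=
  GRing.isLinear.Build k R (H d) *:%R (component d) (component_is_linear d).

Lemma component_val d (v : H d) : component d (\val v) = v.
Proof. by apply/val_inj; exact: pihomog_dE (dhomog_is_dhomog v). Qed.

Lemma ideal_component (J : idealr R) d :
  exists U : {vspace H d}, forall v, v \in U <-> \val v \in J.
Proof.
apply: vspace_of_pred => [|a u v uJ vJ]; first exact: rpred0.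
rewrite linearP /= -mul_mpolyC rpredD // idealMl //.
Qed.

Lemma homog_lin d a (u v : R^o) : (u : R) \is d.-homog -> (v : R) \is d.-homog ->
  (a%:MP *: u + v : R) \is d.-homog.
Proof.
by move=> hu hv; rewrite /GRing.scale /= mul_mpolyC rpredD // rpredZ.
Qed.

Section Quotient.

Variables (J : idealr R) (d : nat) (U : {vspace H d}).
Hypothesis UJ : forall v, v \in U <-> \val v \in J.

(** The kernel is [U], so the image models the degree [d] part of R/J. *)
Let q : 'End(H d) := (\1 - projv U)%VF.

Let lker_q : lker q = U.
Proof.
apply/vspaceP => v; rewrite memv_ker add_lfunE opp_lfunE id_lfunE.
apply/eqP/idP => [/subr0_eq|]; first by move->; exact: memv_proj.
by move=> vU; rewrite projv_id ?subrr.
Qed.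

Let T (f : R) : H d := q (component d f).

Let Tlin a (u v : R^o) : T (a%:MP *: u + v) = a *: T u + T v.
Proof. by rewrite /T {1}/GRing.scale /= mul_mpolyC !linearP. Qed.

Let TJ (v : R) : v \is d.-homog -> (v \in J <-> T v = 0).
Proof.
move=> hv; rewrite -{1}(pihomog_dE hv) -val_component -UJ -lker_q memv_ker.
by split=> /eqP.
Qed.

Lemma hilbertE n : hilbert J d n -> (\dim U + n = 'C(d + 2, 2))%N.
Proof.
move=> Hn; rewrite -dim_dhomog -(limg_ker_dim q fullv) capfv lker_q; congr (_ + _)%N.
apply: (@quot_dimE k R^o _ _ _ T (limg q) n _ _ _ _ _ Hn) => //.
- exact: rpred0.
- by move=> a u v; exact: homog_lin.
- move=> x; split=> [/memv_imgP[v _ ->]|[v _ <-]]; last first.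
    by rewrite memv_img ?memvf.
  by exists (\val v); [exact: dhomog_is_dhomog | congr (q _); exact: component_val].
Qed.

Lemma socle_dim_inj m n : socle_dim J d m -> socle_dim J d n -> m = n.
Proof.
pose P (f : R^o) := (f : R) \is d.-homog /\ in_socle J f.
have P0 : P 0.
  by split; [exact: rpred0 | move=> g _; rewrite mulr0 rpred0].
have Plin a u v : P u -> P v -> P (a%:MP *: u + v).
  move=> [hu su] [hv sv]; split; first exact: homog_lin.
  move=> g Ig; rewrite mulrDr rpredD ?sv // -[_ *: u]/(a%:MP * u : R) mulrCA.
  by rewrite idealMl ?su.
have [||A HA] := @vspace_of_pred _ _ (fun x => exists2 v, P v & T v = x).
- by exists 0 => //; rewrite /T !linear0.
- move=> a _ _ [u Pu <-] [v Pv <-]; exists (a%:MP *: (u : R^o) + v).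
    exact: Plin.
  exact: Tlin.
have key p : socle_dim J d p -> p = \dim A.
  by apply: (@quot_dimE k R^o _ _ _ T A p) => // v [hv _]; exact: TJ.
by move=> /key -> /key ->.
Qed.

End Quotient.

Lemma socle_dim1 (J : idealr R) d : socle_dim J d 1 ->
  exists e, [/\ e \is d.-homog, in_socle J e, e \notin J &
    forall v, v \is d.-homog -> in_socle J v -> exists c, v - c%:MP * e \in J].
Proof.
move=> [e [Pe He]]; have [he se] := Pe 0.
exists (e 0); split=> //; last first.
  move=> v hv sv; have [c [+ _]] := He v (conj hv sv).
  by rewrite big_ord1; exists (c 0 0).
apply/negP => eJ.
(* If the basis element were in [J], every scalar would be a coordinate of 0, against uniqueness. *)
have [c [_ Uc]] := He 0 (conj (rpred0 _) (fun g _ =>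
   eq_ind_r (fun x => x \in J) (rpred0 J) (mulr0 g))).
have all_c (c' : 'rV[k]_1) : c = c'.
  by apply: Uc; rewrite big_ord1 sub0r rpredN; apply: idealMl.
have /rowP/(_ 0) : const_mx 0 = const_mx 1 :> 'rV[k]_1.
  by rewrite -(all_c (const_mx 0)); exact: all_c.
by move/eqP; rewrite !mxE eq_sym oner_eq0.
Qed.

End Hilbert.

(** * Duality *)

Section Duality.

Variables (k : fieldType) (J : idealr {mpoly k[3]}) (N : nat).
Local Notation R := {mpoly k[3]}.
Local Notation pi d := (@pihomog 3 k mdeg d).
Hypothesis homJ : homogeneous J.
Hypothesis topJ : forall e (f : R), (N < e)%N -> f \is e.-homog -> f \in J.

(** [L f] is the coefficient of the degree [N] part of [f] on a socle generator. It detects [J]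
    because every nonzero homogeneous class has a nonzero multiple in the socle, which sits in
    degree [N] alone. *)
Lemma socle_functional : socle_degree J N ->
  exists L : {scalar R},
    (forall h : R, (forall m : R, L (m * h) = 0) <-> h \in J)
    /\ forall h : R, L (pi N h) = L h.
Proof.
move=> socJ; have := socJ N; rewrite eqxx => /socle_dim1[e [he se eJ He]].
have topsoc (f : R) : f \is N.-homog -> in_socle J f.
  move=> hf; apply/in_socleE => i; apply: (@topJ N.+1) => //.
  exact: dhomogM (homogX _ i) hf.
have ex f : exists c, pi N f - c%:MP * e \in J.
  by apply: He (topsoc _ _); exact: pihomogP.
pose l f := xchoose (ex f).
have lP f : pi N f - (l f)%:MP * e \in J by exact: xchooseP (ex f).
have luniq f c : pi N f - c%:MP * e \in J -> l f = c.
  move=> Hc; apply/eqP; rewrite -subr_eq0; apply/contraNT: eJ => nz.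
  have := rpredB Hc (lP f).
  rewrite opprB addrC addrA addrNK -mulrBl -mpolyCB => /(idealMl (l f - c)^-1%:MP).
  by rewrite mulrA -mpolyCM mulVf // mul1r.
have llin : linear_for *%R l.
  move=> a u v; apply: luniq; rewrite linearP /= mpolyCD mpolyCM.
  rewrite -mul_mpolyC mulrDl opprD addrACA -mulrA -mulrBr rpredD ?idealMl //.
pose L : {scalar R} := HB.pack l (GRing.isLinear.Build k R k *%R l llin).
have LE f : L f = l f by [].
exists L; split=> [h|h]; last first.
  by rewrite !LE; apply: luniq; rewrite pihomog_id.
split=> [H|hJ m]; last first.
  by rewrite LE; apply: luniq; rewrite mul0r subr0; apply/homJ/idealMl.
apply: mem_homog_components => d; apply/negPn/negP => nh.
have [E [m [dE hm mh sm]]] := socle_above topJ (pihomogP mdeg d h) nh.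
have EN : E = N.
  apply/eqP; apply: contraNT mh => /negPf EN; have := socJ E; rewrite EN.
  move/socle_dim0; apply => //.
  by rewrite -(subnK dE); exact: dhomogM hm (pihomogP _ _ _).
case/negP: mh; have := lP (m * h); rewrite -LE H mul0r subr0.
by rewrite (pihomogM _ _ hm) -EN leq_subr subKn.
Qed.

(** Both sides are the determinant with rows [u], [v] and (x, y, z). *)
Lemma cross_adjoint (u v : 'rV[R]_3) :
  \sum_i u 0 i * (v *m cross_mx k) 0 i = - \sum_i v 0 i * (u *m cross_mx k) 0 i.
Proof.
rewrite !sum3; have [-> -> ->] := mul_cross u; have [-> -> ->] := mul_cross v.
by ring.
Qed.

Lemma cross_dot (v : 'rV[R]_3) : \sum_i (v *m cross_mx k) 0 i * 'X_i = 0.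
Proof. by rewrite sum3; have [-> -> ->] := mul_cross v; ring. Qed.

Lemma pihomog_cross d (v : 'rV[R]_3) i :
  pi d.+1 ((v *m cross_mx k) 0 i) = (map_mx (pi d) v *m cross_mx k) 0 i.
Proof.
have [c0 c1 c2] := mul_cross v; have [c0' c1' c2'] := mul_cross (map_mx (pi d) v).
case: i => -[|[|[|//]]] H.
- rewrite (_ : Ordinal H = 0) ?c0 ?c0'; last exact/val_inj.
  by rewrite linearB /= !pihomogMX !mxE.
- rewrite (_ : Ordinal H = 1) ?c1 ?c1'; last exact/val_inj.
  by rewrite linearB /= !pihomogMX !mxE.
- rewrite (_ : Ordinal H = 2) ?c2 ?c2'; last exact/val_inj.
  by rewrite linearB /= !pihomogMX !mxE.
Qed.

(** Self-duality pairs Tor_1 in degree d + 1 with Tor_2 in degree N - d + 2. A cycle modulo [J] for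
    the latter has its differential in degree N - d + 1, where [J] is zero, so exactness makes it a
    boundary. *)
Lemma socle_duality_generation d (f : R) : socle_degree J N ->
  (forall g : R, g \is (N - d).+1.-homog -> g \in J -> g = 0) ->
  f \is d.+1.-homog -> f \in J ->
  exists2 g : 'I_3 -> R, forall i, g i \is d.-homog /\ g i \in J
                       & f = \sum_i g i * 'X_i.
Proof.
move=> socJ J0 hf fJ; have [g hg Ef] := homog_irrelevant hf.
(* The truncated difference [N - d] is faithful only for d <= N; beyond that, all forms of degree
   [d] lie in [J]. *)
have [Nd|dN] := ltnP N d.
  by exists g => // i; split=> //; apply: topJ (hg i).
have [L [LJ LN]] := socle_functional socJ.
(* Subtracting a cross product with (x, y, z) does not change the sum of the [g i * 'X_i]. *)
suff [v Hv] : exists v : 'rV[R]_3, forall i, g i - (v *m cross_mx k) 0 i \in J.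
  exists (fun i => pi d (g i - (v *m cross_mx k) 0 i)) => [i|].
    by split; [exact: pihomogP | exact/homJ/Hv].
  rewrite -[LHS](pihomog_dE hf); under eq_bigr => i _ do rewrite -pihomogMX.
  rewrite -raddf_sum /=; congr (pi _ _); rewrite Ef.
  under [RHS]eq_bigr => i _ do rewrite mulrBl.
  by rewrite sumrB cross_dot subr0.
(* [B] is the space of Koszul boundaries; the tests [T] pair with monomials of degree at most [N]
   through [L]. *)
pose B (b : {ffun 'I_3 -> R}) :=
  exists v : 'rV[R]_3, forall i, b i = (v *m cross_mx k) 0 i.
pose T (j : 'I_3 * 'X_{1..3 < N.+1}) (b : {ffun 'I_3 -> R}) := L ('X_[j.2] * b j.1).
have [||||b [v Ev] Hb] := @finite_separation k {ffun 'I_3 -> R} B _ T (finfun g).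
- by move=> j a u v; rewrite /T !ffunE mulrDr -scalerAr linearP.
- by exists 0 => i; rewrite mul0mx mxE ffunE.
- move=> a b1 b2 [v1 E1] [v2 E2]; exists (a%:MP *: v1 + v2) => i.
  by rewrite !ffunE mulmxDl -scalemxAl !mxE -mul_mpolyC E1 E2 !mxE.
- move=> c Hc.
  (* A combination of tests is the pairing with one vector [w]. If it vanishes on [B], adjointness
     makes [w] a cycle modulo [J]. *)
  pose w : 'rV[R]_3 := \row_i \sum_m c (i, m) *: 'X_[bmnm m].
  have wE b : \sum_j c j * T j b = L (\sum_i w 0 i * b i).
    rewrite raddf_sum (eq_bigr (fun j => c (j.1, j.2) * L ('X_[j.2] * b j.1)));
      last by case.
    rewrite -(pair_big predT predT (fun i m => c (i, m) * L ('X_[bmnm m] * b i))) /=.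
    apply: eq_bigr => i _; rewrite mxE mulr_suml raddf_sum; apply: eq_bigr => m _.
    by rewrite /= -scalerAl linearZ.
  have wJ i : (w *m cross_mx k) 0 i \in J.
    apply/LJ => m.
    pose v : 'rV[R]_3 := m *: delta_mx 0 i.
    have Bb : B [ffun j => (v *m cross_mx k) 0 j] by exists v => j; rewrite ffunE.
    have := Hc _ Bb; rewrite wE; under eq_bigr => j _ do rewrite ffunE.
    rewrite cross_adjoint linearN /= => /eqP; rewrite oppr_eq0 => /eqP.
    rewrite (bigD1 i) //= big1 => [|j ji].
      by rewrite !mxE !eqxx mulr1 addr0.
    by rewrite !mxE eqxx (negPf ji) mulr0 mul0r.
  (* In degree N - d this is a true Koszul cycle, hence a multiple [a] of (x, y, z), and its pairing
     with [g] is the value of [L] at [a f], which is 0. *)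
  have w0 : map_mx (pi (N - d)) w *m cross_mx k = 0.
    apply/rowP => i; rewrite -pihomog_cross [RHS]mxE.
    by apply: J0; [exact: pihomogP | exact/homJ/wJ].
  have [a Ea] := (koszul_exact2 _).1 w0.
  have E : pi N (\sum_i w 0 i * (finfun g : {ffun 'I_3 -> R}) i) = a 0 0 * f.
    rewrite linear_sum Ef mulr_sumr; apply: eq_bigr => i _ /=.
    rewrite ffunE mulrC (pihomogM _ _ (hg i)) dN.
    by move/rowP/(_ i): Ea; rewrite !mxE big_ord1 mxE => ->; ring.
  by rewrite wE -LN E; exact: (LJ f).2 fJ _.
exists v => i; apply/LJ => m.
(* Monomials above degree [N] lie in [J], so finitely many tests suffice. *)
have top p : (N < mdeg p)%N -> L ('X_[p] * (g i - (v *m cross_mx k) 0 i)) = 0.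
  move=> Np; rewrite mulrC; apply: (LJ 'X_[p]).2.
  by apply: (topJ Np); rewrite dhomogX.
rewrite (mpolyE m) mulr_suml raddf_sum big1 // => p _ /=.
rewrite -scalerAl linearZ /=.
have [pN|/top->] := leqP (mdeg p) N; last by rewrite mulr0.
have := Hb (i, BMultinom (pN : mdeg p < N.+1)%N); rewrite /T /= Ev ffunE => E.
by rewrite mulrBr linearB /= E subrr mulr0.
Qed.

End Duality.

(** The right kernel of the pairing [L (f g)] lies in [W], so the degree [e] part of R/J embeds in
    the dual of a complement of [U]. *)
Lemma socle_pairing_dim (k : fieldType) (J : idealr {mpoly k[3]}) N d e
    (U : {vspace dhomog 3 k d}) (W : {vspace dhomog 3 k e}) :
  homogeneous J ->
  (forall e (f : {mpoly k[3]}), (N < e)%N -> f \is e.-homog -> f \in J) ->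
  socle_degree J N -> (d + e = N)%N ->
  (forall v, v \in U <-> \val v \in J) -> (forall v, v \in W <-> \val v \in J) ->
  ('C(e + 2, 2) + \dim U <= 'C(d + 2, 2) + \dim W)%N.
Proof.
move=> homJ topJ socJ deN UJ WJ; rewrite -!(dim_dhomog k).
have [L [LJ LN]] := socle_functional homJ topJ socJ.
pose X := vbasis (U^C)%VS.
pose psi (g : dhomog 3 k e) := \row_(i < \dim (U^C)%VS) L (\val X`_i * \val g).
have psilin : linear psi.
  move=> a u v; apply/rowP => i; rewrite !mxE [\val (_ + _)]linearP mulrDr.
  by rewrite -scalerAr linearP.
pose Psi : {linear dhomog 3 k e -> 'rV_(\dim (U^C)%VS)} :=
  HB.pack psi (GRing.isLinear.Build k _ _ *:%R psi psilin).
have kerW : (lker (linfun Psi) <= W)%VS.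
  apply/subvP => g; rewrite memv_ker lfunE => /eqP/rowP Eg.
  apply/WJ/LJ => m; rewrite -LN mulrC (pihomogM _ _ (dhomog_is_dhomog g)).
  rewrite -deN leq_addl addnK mulrC.
  rewrite -[X in X * _]val_component; move: (component d m) => h.
  have /memv_addP[u /UJ uJ [c cX ->]] : h \in (U + U^C)%VS.
    by rewrite addv_complf memvf.
  rewrite linearD mulrDl linearD /= [L (mpoly_of_dhomog u * _)](_ : _ = 0).
    rewrite add0r (coord_vbasis cX) linear_sum mulr_suml linear_sum big1 // => i _.
    rewrite linearZ -scalerAl linearZ /=.
    by have := Eg i; rewrite !mxE => ->; rewrite mulr0.
  by rewrite mulrC; exact: (LJ _).2 uJ _.
rewrite -(limg_ker_dim (linfun Psi) fullv) capfv.
have := dimvS kerW.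
have : (\dim (limg (linfun Psi)) <= \dim (U^C)%VS)%N.
  apply: leq_trans (dimvS (subvf _)) _; by rewrite dimvf /dim /= mul1n.
have := dimv_compl U; have := dimvS (subvf U). move: (\dim (limg _)) (\dim (lker _)); move: (\dim (U^C)%VS) (\dim U) (\dim W) => *; lia.
Qed.

(** * The second Koszul homology *)

(** The cross product with (x, y, z) sends the Tor_2 cycles of degree [s.+2] onto the triples in [J]
    of degree [s.+1] orthogonal to (x, y, z). As [J] is zero in degree [s], its kernel is exactly
    the boundaries; rank-nullity for multiplication by the variables concludes. It is applied with
    [s] one below the socle degree of R/I_1. *)
Lemma tor2_dim (k : fieldType) (J : idealr {mpoly k[3]}) s b
    (U : {vspace dhomog 3 k s.+1}) :
  homogeneous J ->
  (forall f : {mpoly k[3]}, f \is s.-homog -> f \in J -> f = 0) ->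
  (forall v, v \in U <-> \val v \in J) ->
  tor_dim J 2 s.+2 b ->
  exists V : {vspace dhomog 3 k s.+2},
    (forall v, v \in V <->
       exists2 g : 'I_3 -> {mpoly k[3]},
         forall i, g i \is s.+1.-homog /\ g i \in J & \val v = \sum_i g i * 'X_i)
    /\ (\dim V + b = 3 * \dim U)%N.
Proof.
move=> homJ J0 UJ Hb.
pose n := \dim U; pose X := vbasis U.
(* A matrix encodes a triple of elements of [U] by its coordinates in the basis [X]. *)
pose w (M : 'M[k]_(3, n)) (i : 'I_3) := \sum_(j < n) M i j *: X`_j.
have wU M i : w M i \in U.
  apply: memv_suml => j _; apply: memvZ; apply: vbasis_mem.
  by rewrite mem_nth ?size_tuple.
have wlin i : linear (w^~ i).
  move=> a u v; rewrite /w scaler_sumr -big_split; apply: eq_bigr => j _ /=.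
  by rewrite !mxE scalerDl scalerA.
pose mu M : dhomog 3 k s.+2 := component s.+2 (\sum_i \val (w M i) * 'X_i).
have mulin : linear mu.
  move=> a u v; rewrite /mu -linearP; congr (component _ _).
  rewrite scaler_sumr -big_split; apply: eq_bigr => i _ /=.
  by rewrite wlin linearP mulrDl -scalerAl.
pose Mu : {linear 'M[k]_(3, n) -> dhomog 3 k s.+2} :=
  HB.pack mu (GRing.isLinear.Build k _ _ *:%R mu mulin).
have muE M : \val (mu M) = \sum_i \val (w M i) * 'X_i.
  rewrite val_component pihomog_dE //; apply: rpred_sum => i _.
  by rewrite -(addn1 s.+1); exact: dhomogM (dhomog_is_dhomog _) (homogX k i).
have coordw (f : {mpoly k[3]}) : f \is s.+1.-homog -> f \in J ->
    component s.+1 f = \sum_(j < n) coord X j (component s.+1 f) *: X`_j.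
  by move=> hf fJ; apply/coord_vbasis/UJ; rewrite val_component pihomog_dE.
exists (limg (linfun Mu)); split=> [v|].
  split=> [/memv_imgP[M _ ->]|[g gJ Ev]].
    rewrite lfunE; exists (fun i => \val (w M i)); last exact: muE.
    by move=> i; split; [exact: dhomog_is_dhomog | apply/UJ].
  apply/memv_imgP; exists (\matrix_(i, j) coord X j (component s.+1 (g i))).
    exact: memvf.
  apply/val_inj; rewrite lfunE Ev muE; apply: eq_bigr => i _; congr (_ * _).
  have [hg giJ] := gJ i; rewrite -[LHS](pihomog_dE hg) -val_component.
  by rewrite coordw // /w; under [in RHS]eq_bigr do rewrite mxE.
have -> : (3 * \dim U = \dim {:'M[k]_(3, n)})%N by rewrite dimvf.
rewrite -(limg_ker_dim (linfun Mu) fullv) capfv addnC; congr (_ + _)%N.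
pose T (u : 'rV[{mpoly k[3]}]_3) : 'M[k]_(3, n) :=
  \matrix_(i, j) coord X j (component s.+1 ((u *m cross_mx k) 0 i)).
have chainE (u : 'rV[{mpoly k[3]}]_3) :
    @chain_homog k (koszul k) 2 s.+2 u <-> forall i, u 0 i \is s.-homog.
  by split=> H i; have := H i; rewrite /= subSS subSS subn0.
have homog_cross (u : 'rV[{mpoly k[3]}]_3) i : (forall i, u 0 i \is s.-homog) ->
    (u *m cross_mx k) 0 i \is s.+1.-homog.
  move=> hu; have <- : map_mx (pihomog mdeg s) u = u.
    by apply/rowP => j; rewrite mxE pihomog_dE.
  by rewrite -pihomog_cross; exact: pihomogP.
have T0 (u : 'rV[{mpoly k[3]}]_3) : (forall i, u 0 i \is s.-homog) ->
    (forall i, (u *m cross_mx k) 0 i \in J) ->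
    (u *m cross_mx k = 0 <-> T u = 0).
  move=> hu cu; split=> [E|/matrixP E]; last apply/rowP => i.
    by apply/matrixP => i j; rewrite mxE E !mxE !linear0.
  rewrite -[LHS](pihomog_dE (homog_cross u i hu)) -val_component.
  rewrite coordw ?homog_cross // big1 => [|j _]; first by rewrite mxE.
  by have := E i j; rewrite mxE [RHS]mxE => ->; rewrite scale0r.
apply: (@quot_dimE k 'rV[{mpoly k[3]}]_3 _ _ _ T (lker (linfun Mu)) b _ _ _ _ _ Hb).
- move=> a u v; apply/matrixP => i j; rewrite mxE mulmxDl -scalemxAl !mxE.
  by rewrite mul_mpolyC !linearP.
- split; first by apply/chainE => i; rewrite mxE rpred0.
  by move=> i; rewrite /= mul0mx mxE rpred0.
- move=> a u v [/chainE hu cu] [/chainE hv cv]; split.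
    by apply/chainE => i; rewrite !mxE mul_mpolyC rpredD ?rpredZ.
  move=> i; rewrite /= mulmxDl -scalemxAl mxE; apply: rpredD; last exact: cv.
  by rewrite mxE; apply/idealMl/cu.
(* In degree [s] a boundary modulo [J] is a true boundary, so its cross product is zero; the
   converse is exactness. *)
- move=> u [/chainE hu cu]; rewrite -(T0 u hu cu); split=> [[v Hv]|/koszul_exact2[v Ev]].
    have vX : (v *m koszul_diff k 2) *m cross_mx k = 0.
      by apply/koszul_exact2; exists v.
    apply/rowP => i; rewrite [RHS]mxE -(pihomog_dE (homog_cross u i hu)).
    rewrite -[u](subrK (v *m koszul_diff k 2)) mulmxDl vX addr0 pihomog_cross.
    rewrite (_ : map_mx _ _ = 0) ?mul0mx ?mxE //; apply/rowP => j; rewrite mxE [RHS]mxE.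
    by apply: J0; [exact: pihomogP | exact/homJ/Hv].
  by exists v => i; rewrite /= -Ev subrr mxE rpred0.
- move=> M; rewrite memv_ker lfunE; split=> [/eqP EM|[u [/chainE hu cu] <-]].
    have EM0 : \val (mu M) = 0 by rewrite (EM : mu M = 0).
    (* A triple orthogonal to (x, y, z) is a cross product by exactness; the degree [s] part of [v]
       is the required cycle. *)
    have : (\row_i \val (w M i) : 'rV_3) *m (\col_a 'X_a) = 0.
      apply/rowP => i; rewrite !mxE -[RHS]EM0 muE.
      by apply: eq_bigr => j _; rewrite !mxE.
    move=> /koszul_exact1[v Ev]; pose u := map_mx (pihomog mdeg s) v.
    have Eu i : (u *m cross_mx k) 0 i = \val (w M i).
      rewrite -pihomog_cross -Ev mxE pihomog_dE //; exact: dhomog_is_dhomog.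
    exists u.
      split; first by apply/chainE => i; rewrite mxE pihomogP.
      by move=> i; rewrite /= [_ 0 i]Eu; apply/UJ.
    apply/matrixP => i j; rewrite mxE Eu component_val.
    by rewrite coord_sum_free // (basis_free (vbasisP U)).
  apply/eqP/val_inj; rewrite /= [LHS]muE -[RHS](cross_dot u).
  apply: eq_bigr => i _; congr (_ * _).
  rewrite -[RHS](pihomog_dE (homog_cross u i hu)) -val_component.
  by rewrite coordw ?homog_cross // /w; under eq_bigr do rewrite mxE.
Qed.

(** * Minimal generators *)

Lemma free_comb_mem (K : fieldType) (V : vectType K) n (X : n.-tuple V)
    (P : pred 'I_n) (c : 'I_n -> K) (i0 : 'I_n) :
  free X -> X`_i0 = \sum_(i | P i) c i *: X`_i -> P i0.
Proof.
move=> /freeP fX E; apply/negPn/negP => nP.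
have : (i0 == i0)%:R - (if P i0 then c i0 else 0) = 0.
  apply: (fX (fun i => (i == i0)%:R - (if P i then c i else 0))).
  under eq_bigr do rewrite scalerBl.
  rewrite sumrB (bigD1 i0) //= eqxx scale1r big1 => [|i /negPf->]; last exact: scale0r.
  rewrite addr0 E big_mkcond -sumrB big1 // => i _.
  by case: ifP; rewrite ?scale0r subrr.
by rewrite eqxx (negPf nP) subr0 => /eqP; rewrite oner_eq0.
Qed.

Section GenIdeal.

Variables (k : fieldType) (T : finType) (P : pred T) (g : T -> {mpoly k[3]}).

Lemma gen_ideal0 : gen_ideal P g 0.
Proof. by exists (fun=> 0); rewrite big1 // => t _; rewrite mul0r. Qed.

Lemma gen_idealD f h : gen_ideal P g f -> gen_ideal P g h -> gen_ideal P g (f + h).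
Proof.
move=> [a ->] [c ->]; exists (fun t => a t + c t).
by rewrite -big_split; apply: eq_bigr => t _; rewrite mulrDl.
Qed.

Lemma gen_idealM a f : gen_ideal P g f -> gen_ideal P g (a * f).
Proof.
move=> [c ->]; exists (fun t => a * c t); rewrite mulr_sumr.
by apply: eq_bigr => t _; rewrite mulrA.
Qed.

Lemma gen_ideal_sum (A : Type) (r : seq A) (Q : pred A) (F : A -> {mpoly k[3]}) :
  (forall i, Q i -> gen_ideal P g (F i)) -> gen_ideal P g (\sum_(i <- r | Q i) F i).
Proof. by move=> H; apply: big_ind => //; [exact: gen_ideal0 | exact: gen_idealD]. Qed.

Lemma gen_ideal_gen t : P t -> gen_ideal P g (g t).
Proof.
move=> Pt; exists (fun t' => (t' == t)%:R); rewrite (bigD1 t) //= eqxx mul1r.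
by rewrite big1 ?addr0 // => i /andP[_ /negPf->]; rewrite mul0r.
Qed.

Lemma gen_ideal_sub (J : idealr {mpoly k[3]}) f :
  (forall t, P t -> g t \in J) -> gen_ideal P g f -> f \in J.
Proof. by move=> gJ [a ->]; apply: rpred_sum => t Pt; apply/idealMl/gJ. Qed.

End GenIdeal.

Section MinimalGenerators.

Variables (k : fieldType) (J : idealr {mpoly k[3]}) (s m b : nat).
Local Notation R := {mpoly k[3]}.
Local Notation pi d := (@pihomog 3 k mdeg d).
Local Notation H d := (dhomog 3 k d).

Variables (U : {vspace H s}) (U' V : {vspace H s.+1}).
Variables (X : m.-tuple (H s)) (Y : b.-tuple (H s.+1)).
Hypothesis homJ : homogeneous J.
Hypothesis low : forall d (f : R), (d < s)%N -> f \is d.-homog -> f \in J -> f = 0.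
Hypothesis high : forall d (f : R), (s < d)%N -> f \is d.+1.-homog -> f \in J ->
  exists2 g : 'I_3 -> R, forall i, g i \is d.-homog /\ g i \in J
                       & f = \sum_i g i * 'X_i.
Hypothesis UJ : forall v, v \in U <-> \val v \in J.
Hypothesis UJ' : forall v, v \in U' <-> \val v \in J.
Hypothesis VJ : forall v, v \in V <->
  exists2 g : 'I_3 -> R, forall i, g i \is s.-homog /\ g i \in J
                       & \val v = \sum_i g i * 'X_i.
Hypothesis basisX : basis_of U X.
Hypothesis basisY : basis_of (U' :\: V)%VS Y.

(** [X] is a basis of [J] in degree [s]; [Y] is a basis of a complement, in degree [s.+1], of what
    degree [s] generates. *)
Definition generators (t : 'I_m + 'I_b) : R :=
  match t with inl i => \val X`_i | inr j => \val Y`_j end.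

Lemma generators_mem t : generators t \in J.
Proof.
case: t => i /=; first by apply/UJ/(basis_mem basisX)/mem_nth; rewrite size_tuple.
apply/UJ'/(subvP (diffvSl U' V))/(basis_mem basisY)/mem_nth.
by rewrite size_tuple.
Qed.

(** Induction on the degree of a component: zero below [s], [X] in degree [s], [V] and [Y] in degree
    [s.+1], and [high] to step down from larger degrees. *)
Lemma generators_span (f : R) : f \in J -> gen_ideal predT generators f.
Proof.
have mem_gen t : gen_ideal predT generators (generators t) by exact: gen_ideal_gen.
have span_s (h : R) : h \is s.-homog -> h \in J -> gen_ideal predT generators h.
  move=> hh hJ; have : component s h \in U by apply/UJ; rewrite val_component pihomog_dE.
  move/(coord_basis basisX)/(congr1 val); rewrite val_component pihomog_dE // => ->.
  rewrite linear_sum; apply: gen_ideal_sum => i _; rewrite linearZ /= -mul_mpolyC.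
  by apply/gen_idealM/(mem_gen (inl i)).
have step d (h : R) : (forall h : R, h \is d.-homog -> h \in J ->
    gen_ideal predT generators h) ->
    (exists2 g : 'I_3 -> R, forall i, g i \is d.-homog /\ g i \in J
      & h = \sum_i g i * 'X_i) -> gen_ideal predT generators h.
  move=> IH [g Hg ->]; apply: gen_ideal_sum => i _; rewrite mulrC.
  by have [hg gJ] := Hg i; apply/gen_idealM/IH.
have span_s1 (h : R) : h \is s.+1.-homog -> h \in J -> gen_ideal predT generators h.
  move=> hh hJ.
  have : component s.+1 h \in U' by apply/UJ'; rewrite val_component pihomog_dE.
  move/(subvP (addvSl U' V)); rewrite -addv_diff => /memv_addP[c cC [v vV E]].
  move/(congr1 val): E; rewrite val_component pihomog_dE // => ->.
  rewrite [\val _]linearD; apply: gen_idealD; last by apply: step span_s _; exact/VJ.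
  rewrite (coord_basis basisY cC) linear_sum; apply: gen_ideal_sum => j _.
  by rewrite linearZ /= -mul_mpolyC; apply/gen_idealM/(mem_gen (inr j)).
suff H d (h : R) : h \is d.-homog -> h \in J -> gen_ideal predT generators h.
  move=> fJ; rewrite (pihomog_partitionE (leqnn (mmeasure mdeg f))).
  by apply: gen_ideal_sum => d _; apply: H (pihomogP _ _ _) (homJ _ fJ).
elim: d h => [|d IH] h hh hJ.
  case: (posnP s) => [s0|s0]; first by apply: span_s; rewrite ?s0.
  by rewrite (low s0 hh hJ); exact: gen_ideal0.
have [ds|ds|E] := ltngtP d.+1 s; last by apply: span_s; rewrite -?E.
  by rewrite (low ds hh hJ); exact: gen_ideal0.
have [E|sd|E] := ltngtP d s; first by lia.
  exact: (step d _ IH) (high _ _ _).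
by apply: span_s1; rewrite -?E.
Qed.

Lemma pihomog0C (a : R) : pi 0%N a = (a@_0%MM)%:MP.
Proof.
rewrite -{1}[a](subrK (a@_0%MM)%:MP) linearD /=.
have /irrelevantE[c ->] : (a - (a@_0%MM)%:MP)@_0%MM = 0.
  by rewrite mcoeffB mcoeffC eqxx mulr1 subrr.
rewrite linear_sum big1 => [|i _] /=.
  by rewrite add0r pihomog_dE // -[_%:MP]mulr1 mul_mpolyC rpredZ // dhomog1.
by rewrite mulrC (pihomogM _ _ (homogX k i)).
Qed.

Lemma pihomog_mul_self d (a : R) (v : H d) : pi d (a * \val v) = a@_0%MM *: \val v.
Proof.
rewrite mulrC (pihomogM _ _ (dhomog_is_dhomog v)) leqnn subnn.
by rewrite pihomog0C mulrC mul_mpolyC.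
Qed.

(** Graded Nakayama: in the degree of a generator, and modulo products with R_+, only constant terms
    of the coefficients survive, and freeness of [X] or [Y] applies. *)
Lemma generators_irredundant (P : pred ('I_m + 'I_b)) :
  (forall f, f \in J -> gen_ideal P generators f) -> forall t, P t.
Proof.
move=> HP [i0|j0].
  have [a Ea] := HP _ (generators_mem (inl i0)).
  apply: (@free_comb_mem _ _ _ X (fun i => P (inl i)) (fun i => (a (inl i))@_0%MM)).
    exact: basis_free basisX.
  apply/val_inj; rewrite linear_sum.
  have {1}-> : \val X`_i0 = pi s (\val X`_i0) by rewrite pihomog_dE ?dhomog_is_dhomog.
  rewrite [\val X`_i0]Ea linear_sum big_sumType /= [X in _ + X]big1 ?addr0.
    by apply: eq_bigr => i _; rewrite pihomog_mul_self.
  move=> j _; rewrite mulrC (pihomogM _ _ (dhomog_is_dhomog _)).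
  by rewrite ltnn.
have [a Ea] := HP _ (generators_mem (inr j0)).
apply: (@free_comb_mem _ _ _ Y (fun j => P (inr j)) (fun j => (a (inr j))@_0%MM)).
  exact: basis_free basisY.
have YC (j : 'I_b) : Y`_j \in (U' :\: V)%VS.
  by apply: (basis_mem basisY); rewrite mem_nth ?size_tuple.
(* The difference lies in the complement spanned by [Y] and, as a sum of linear multiples of [X],
   also in [V]. *)
apply/eqP; rewrite -subr_eq0 -memv0 -(capv_diff U' V) memv_cap.
rewrite rpredB ?YC //=; last by apply: rpred_sum => j _; apply/memvZ/YC.
have -> : Y`_j0 - \sum_(j | P (inr j)) (a (inr j))@_0%MM *: Y`_j =
    \sum_(i | P (inl i)) component s.+1 (a (inl i) * \val X`_i).
  apply/eqP; rewrite subr_eq; apply/eqP/val_inj; rewrite [RHS]linearD !linear_sum /=.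
  have {1}-> : \val Y`_j0 = pi s.+1 (\val Y`_j0) by rewrite pihomog_dE ?dhomog_is_dhomog.
  rewrite [\val Y`_j0]Ea linear_sum big_sumType /=; congr (_ + _).
  by apply: eq_bigr => j _; rewrite pihomog_mul_self.
apply: rpred_sum => i _; apply/VJ.
have [c hc Ec] := homog_irrelevant (pihomogP mdeg 1 (a (inl i))).
exists (fun l => c l * \val X`_i) => [l|].
  split; last exact/idealMl/(generators_mem (inl i)).
  exact: dhomogM (hc l) (dhomog_is_dhomog _).
rewrite val_component mulrC (pihomogM _ _ (dhomog_is_dhomog _)) leqnSn subSnn Ec.
by rewrite mulr_sumr; apply: eq_bigr => l _; rewrite mulrCA mulrA.
Qed.

Lemma generators_minimal : minimal_generators generators J.
Proof.
split=> [f|P HP]; last by apply: generators_irredundant => f /HP.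
split; first exact: generators_span.
by apply: gen_ideal_sub => t _; exact: generators_mem.
Qed.

End MinimalGenerators.

(** * The decomposition *)

Lemma exists_basis_tuple (K : fieldType) (V : vectType K) (U : {vspace V}) n :
  \dim U = n -> exists B : n.-tuple V, basis_of U B.
Proof. by move<-; exists (vbasis U); exact: vbasisP. Qed.

(** Forms of top degree are socle elements, so the top degree is a socle degree, and it is at least
    the larger of the two. *)
Lemma compressed_top_degree (k : fieldType) (s : nat) (I : idealr {mpoly k[3]}) :
  (1 < s)%N -> compressed I ->
  (forall d, socle_dim I d ((d == s) + (d == 2 * s - 1))%N) ->
  top_degree I (2 * s - 1).
Proof.
move=> s1 [N [c [[[f hf fI] top] _ _]]] soc.
have sf : in_socle I f.
  apply/in_socleE => i; apply: (top N.+1) => //; exact: dhomogM (homogX k i) hf.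
have soc1 : socle_dim I (2 * s - 1) 1.
  have := soc (2 * s - 1)%N.
  by rewrite eqxx (_ : (_ == s) = false) //; apply/eqP; lia.
have [e [he se eI _]] := socle_dim1 soc1.
have sN : (2 * s - 1 <= N)%N.
  by rewrite leqNgt; apply: contra eI => Ns; exact: top he.
suff <- : N = (2 * s - 1)%N by split=> //; exists f.
apply/eqP; apply: contraNT fI => /negPf NE; apply: (socle_dim0 _ hf sf).
by have := soc N; rewrite NE (_ : (N == s) = false) //; apply/eqP; lia.
Qed.

(** In both degrees the minimum in [compressed] is the socle sum: 1 + C(s + 1, 2) in degree s, and
    C(s, 2) in degree s + 1, where the socle element of degree s no longer counts. *)
Lemma compressed_dims (k : fieldType) (s : nat) (I : idealr {mpoly k[3]})
    (U : {vspace dhomog 3 k s}) (U' : {vspace dhomog 3 k s.+1}) :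
  (1 < s)%N -> compressed I ->
  (forall d, socle_dim I d ((d == s) + (d == 2 * s - 1))%N) ->
  (forall v, v \in U <-> \val v \in I) -> (forall v, v \in U' <-> \val v \in I) ->
  \dim U = s /\ \dim U' = (3 * s.+1)%N.
Proof.
move=> s1 compI soc UI UI'.
have [[g hg gI] topI] := compressed_top_degree s1 compI soc.
have [N [c [[[f hf fI] topN] socc hilb]]] := compI.
have EN : N = (2 * s - 1)%N.
  apply/eqP; rewrite eqn_leq; apply/andP; split; rewrite leqNgt.
    by apply: contra fI => Ns; exact: topI hf.
  by apply: contra gI => Ns; exact: topN hg.
have cE l : c l = ((l == s) + (l == 2 * s - 1))%N.
  have [W WI] := ideal_component I l.
  exact: (socle_dim_inj WI (socc l) (soc l)).
have pick a i n F : (i <= a < n)%N -> (\sum_(i <= l < n) (l == a) * F l)%N = F a.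
  move=> /andP[ia an]; rewrite (bigD1_seq a) ?mem_index_iota ?ia ?iota_uniq //=.
  by rewrite eqxx mul1n big1 ?addn0 // => l /negPf->.
have sumE i F : (\sum_(i <= l < N.+1) c l * F l =
    \sum_(i <= l < N.+1) (l == s) * F l + \sum_(i <= l < N.+1) (l == 2 * s - 1) * F l)%N.
  by rewrite -big_split; apply: eq_bigr => l _; rewrite cE mulnDl.
have binSn n : 'C(n.+1, 2) = ('C(n, 2) + n)%N by rewrite binS bin1.
have bin_top n : 'C(2 + n, n) = 'C(n.+2, 2) by rewrite addnC -[LHS]bin_sub ?leq_addr // addKn addn2.
have : hilbert I s (s.+1 + 'C(s, 2)).
  have := hilb s; rewrite sumE !pick; try lia.
  rewrite subnn bin0 !bin_top EN => /(_ ltac:(lia)).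
  rewrite (_ : (2 * s - 1 - s).+2 = s.+1); last by lia.
  by rewrite !binSn; congr (hilbert _ _ _); lia.
have : hilbert I s.+1 'C(s, 2).
  have := hilb s.+1; rewrite sumE big_nat big1 ?add0n => [|l /andP[sl _]]; last first.
    by rewrite gtn_eqF.
  rewrite pick; last by lia.
  rewrite !bin_top EN => /(_ ltac:(lia)).
  rewrite (_ : (2 * s - 1 - s.+1).+2 = s); last by lia.
  by rewrite !binSn; congr (hilbert _ _ _); lia.
move=> /(hilbertE UI') + /(hilbertE UI); rewrite !addn2 !binSn; lia.
Qed.

Theorem proposition4p3 (k : fieldType) (s : nat) (hs : (3 <= s)%N)
    (I I1 I2 : idealr {mpoly k[3]})
    (hI : homogeneous I) (hgrade : grade I 3) (hcomp : compressed I)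
    (hsoc : forall d, socle_dim I d ((d == s) + (d == 2 * s - 1))%N)
    (hdec : forall f, (f \in I) = (f \in I1) && (f \in I2))
    (hI1 : grade3_Gorenstein I1) (hI2 : grade3_Gorenstein I2)
    (hs1 : socle_degree I1 s) (hs2 : socle_degree I2 (2 * s - 1)%N)
    (b : nat) (hb : tor_dim I2 2 s.+1 b) :
  exists (phi : 'I_s.+1 -> {mpoly k[3]}) (psi : 'I_b -> {mpoly k[3]}),
    let g := fun t : 'I_s.+1 + 'I_b =>
               match t with inl i => phi i | inr j => psi j end in
    [/\ forall i, phi i \is s.-homog,
        forall j, psi j \is s.+1.-homog,
        minimal_generators g I2
      & forall f, f \in I <->
          exists u v, [/\ gen_ideal (fun t => t != inl ord_max) g u,
                          irrelevant v & f = u + v * phi ord_max]].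
Proof.
have [hom2 _ _] := hI2.
case: s => [//|t] in hs hsoc hs1 hs2 hb *; set s := t.+1.
have [_ topI] := compressed_top_degree (ltnW hs) hcomp hsoc.
have subI1 f : f \in I -> f \in I1 by rewrite hdec => /andP[].
have subI2 f : f \in I -> f \in I2 by rewrite hdec => /andP[].
have top2 e f : (2 * s - 1 < e)%N -> f \is e.-homog -> f \in I2.
  by move=> se hf; apply/subI2/(topI e).
(* A form of degree above s outside I_1 would have a multiple in the socle of R/I_1 in degree above
   s. *)
have top1 e f : (s < e)%N -> f \is e.-homog -> f \in I1.
  move=> se hf; apply/negPn/negP => nf.
  have [|E [m [eE hm mf sf]]] := socle_above (N := (2 * s - 1)%N) _ hf nf.
    by move=> e' g' se' hg'; apply/subI1/(topI e').
  case/negP: mf; apply: (socle_dim0 (d := E)) => //.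
    by have := hs1 E; rewrite gtn_eqF // (leq_trans se).
  by rewrite -(subnK eE); exact: dhomogM hm hf.
have soc_s : socle_dim I s 1.
  have := hsoc s.
  by rewrite eqxx (_ : (_ == (_ - 1)%N) = false) //; apply/eqP; lia.
have [p [hp sp pI _]] := socle_dim1 soc_s.
have p2 : p \in I2.
  apply: (socle_dim0 (d := s)) => //.
    by have := hs2 s; rewrite (_ : (_ == (_ - 1)%N) = false) //; apply/eqP; lia.
  by move=> g /sp; exact: subI2.
have p1 : p \notin I1 by apply: contra pI; rewrite hdec p2 andbT.
(* All forms of degree s are socle elements modulo I_1, and that socle is a line, so [p] spans
   it. *)
have mod1 v : v \is s.-homog -> exists c, v - c%:MP * p \in I1.
  have := hs1 s; rewrite eqxx => /socle_dim1[e [he _ _ He]].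
  have soc1 f : f \is s.-homog -> in_socle I1 f.
    move=> hf; apply/in_socleE => i; apply: (top1 s.+1) => //.
    exact: dhomogM (homogX k i) hf.
  have [c pc] := He p hp (soc1 _ hp); move=> hv; have [c' vc] := He v hv (soc1 _ hv).
  have c0 : c != 0.
    by apply: contra p1 => /eqP c0; move: pc; rewrite c0 mul0r subr0.
  exists (c' / c).
  have -> : v - (c' / c)%:MP * p = (v - c'%:MP * e) - (c' / c)%:MP * (p - c%:MP * e).
    rewrite mulrBr mulrA -mpolyCM divfK //; ring.
  by rewrite rpredB // idealMl.
have above f d : (s < d)%N -> f \is d.-homog -> f \in I2 -> f \in I.
  by move=> sd hf f2; rewrite hdec f2 (top1 d).
have [U UI] := ideal_component I s.
have [U' UI'] := ideal_component I s.+1.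
have [dU dU'] := compressed_dims (ltnW hs) hcomp hsoc UI UI'.
have [W WI] := ideal_component I2 s.
have WI' v : v \in U' <-> \val v \in I2.
  split=> [/UI'/subI2 //|v2]; apply/UI'/(above _ s.+1) => //; exact: dhomog_is_dhomog.
have pU : component s p \notin U by apply/negP => /UI; rewrite val_component pihomog_dE ?(negPf pI).
have [B basisB] := exists_basis_tuple dU.
(* Putting [p] last makes it the generator of index [ord_max]. *)
pose X := [tuple of rcons B (component s p)].
have basisX : basis_of W X.
  have freeX : free X.
    have /perm_free -> : perm_eq X (component s p :: B) by rewrite perm_rcons.
    by rewrite free_cons (span_basis basisB) pU (basis_free basisB).
  rewrite /basis_of freeX andbT eqEsubv [tval X]/= -cats1 span_cat span_seq1.
  rewrite (span_basis basisB); apply/andP; split.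
    apply/subvP => v /memv_addP[u /UI uI [_ /vlineP[c ->] ->]].
    apply/WI; rewrite linearD linearZ /= -mul_mpolyC pihomog_dE // rpredD ?idealMl //.
    exact: subI2.
  apply/subvP => v /WI v2; have [c vc] := mod1 _ (dhomog_is_dhomog v).
  rewrite -[v](subrK (c *: component s p)); apply: memv_add; last exact/memvZ/memv_line.
  have vI : \val v - c%:MP * p \in I by rewrite hdec vc rpredB // idealMl.
  by apply/UI; rewrite [\val _]linearB linearZ /= -mul_mpolyC pihomog_dE // mulrN.
have dW : \dim W = s.+1 by rewrite (vector.size_basis basisX).
(* The pairing between degrees s - 1 and s gives C(s + 2, 2) + dim Z <= C(s + 1, 2) + s + 1, which
   forces Z = 0. *)
have low_t f : f \is t.-homog -> f \in I2 -> f = 0.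
  move=> hf f2; have [Z ZI] := ideal_component I2 t.
  have := socle_pairing_dim hom2 top2 hs2 (_ : t + s = _)%N ZI WI => /(_ ltac:(lia)).
  rewrite dW !addn2 binS bin1 -/s => dZ.
  have Z0 : Z = 0%VS by apply/eqP; rewrite -dimv_eq0; lia.
  have : component t f \in Z by apply/ZI; rewrite val_component pihomog_dE.
  by rewrite Z0 memv0 => /eqP/(congr1 val); rewrite val_component pihomog_dE.
(* Multiplication by x is injective and lifts lower degrees to degree s - 1. *)
have low d (f : {mpoly k[3]}) : (d < s)%N -> f \is d.-homog -> f \in I2 -> f = 0.
  move=> ds; have [n En] : exists n, (n + d = t)%N by exists (t - d)%N; rewrite subnK.
  elim: n d f En {ds} => [|n IH] d f En hf f2; first by apply: low_t; rewrite -?En.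
  have /eqP : 'X_0 * f = 0.
    apply: (IH d.+1); [by rewrite addnS | exact: dhomogM (homogX k 0) hf | exact: idealMl].
  by rewrite mulf_eq0 (negPf (X_neq0 _ _)) => /eqP.
have [V [VI dV]] := tor2_dim hom2 low_t WI hb.
(* For d > s the dual degree (2s - 1 - d) + 1 is below s, where I_2 is zero. *)
have high d (f : {mpoly k[3]}) : (s < d)%N -> f \is d.+1.-homog -> f \in I2 ->
    exists2 g : 'I_3 -> {mpoly k[3]}, forall i, g i \is d.-homog /\ g i \in I2
      & f = \sum_i g i * 'X_i.
  move=> sd; apply: (socle_duality_generation hom2 top2 hs2) => g.
  by apply: low; rewrite /s; lia.
have VU' : (V <= U')%VS.
  apply/subvP => v /VI[g gI Ev]; apply/WI'; rewrite Ev; apply: rpred_sum => i _.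
  by rewrite mulrC idealMl //; have [] := gI i.
(* The complement has dimension b because dim U' = 3(s + 1) = 3 dim W = dim V + b. *)
have [Y basisY] : exists Y : b.-tuple (dhomog 3 k s.+1), basis_of (U' :\: V)%VS Y.
  apply: exists_basis_tuple; apply/eqP.
  rewrite -(eqn_add2l (\dim V)) dV dW -{1}(capv_idPr VU').
  by rewrite dimv_cap_compl dU'.
have gen2 := generators_minimal hom2 low high WI WI' VI basisX basisY.
have Xlast : \val X`_(@ord_max s) = p.
  by rewrite nth_rcons size_tuple ltnn eqxx val_component pihomog_dE.
have genI (t' : 'I_s.+1 + 'I_b) : t' != inl ord_max -> generators X Y t' \in I.
  case: t' => [i|j] ne; last first.
    by apply: (above _ s.+1) (generators_mem WI WI' basisX basisY (inr j));
       rewrite ?dhomog_is_dhomog.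
  have iU : (i < s)%N.
    by rewrite ltn_neqAle -ltnS ltn_ord andbT; apply: contra ne.
  rewrite /= nth_rcons size_tuple iU; apply/UI/(basis_mem basisB)/mem_nth.
  by rewrite size_tuple.
exists (fun i => \val X`_i), (fun j => \val Y`_j); split.
- by move=> i; exact: dhomog_is_dhomog.
- by move=> j; exact: dhomog_is_dhomog.
- exact: gen2.
move=> f; rewrite Xlast; split=> [fI|[u [v [Gu Iv ->]]]]; last first.
  by rewrite rpredD ?sp //; exact: gen_ideal_sub genI Gu.
have [a Ea] := (gen2.1 f).1 (subI2 _ fI).
pose u := \sum_(t' | t' != inl ord_max) a t' * generators X Y t'.
pose v := a (inl ord_max).
have fE : f = u + v * p by rewrite Ea (bigD1 (inl ord_max)) //= Xlast addrC.
exists u, v; split=> //; first by exists a.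
have uI : u \in I by apply: (gen_ideal_sub genI); exists a.
(* Since [v p] and R_+ [p] lie in I, a nonzero constant term of [v] would put [p] itself in I. *)
apply/irrelevantE; apply: contraNeq pI => v0.
have vp : (v@_0%MM)%:MP * p \in I.
  have -> : (v@_0%MM)%:MP * p = (f - u) - (v - (v@_0%MM)%:MP) * p by rewrite fE; ring.
  rewrite !rpredB // sp //; apply/irrelevantE.
  by rewrite mcoeffB mcoeffC eqxx mulr1 subrr.
by have := idealMl (v@_0%MM)^-1%:MP vp; rewrite mulrA -mpolyCM mulVf // mul1r.
Qed.
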